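(* Let $\rho=\sum_{i=1}^4\lambda_i\Pi_i$ and $\rho'=\sum_{i=1}^4\lambda'_i\Pi_i$ be two entangled two-qubit Bell-diagonal states whose weight vectors $\vec\lambda=(\lambda_1,\lambda_2,\lambda_3,\lambda_4)$ and $\vec\lambda'=(\lambda'_1,\lambda'_2,\lambda'_3,\lambda'_4)$ satisfy $\lambda_1\ge\lambda_2\ge\lambda_3\ge\lambda_4$ and $\lambda'_1\ge\lambda'_2\ge\lambda'_3\ge\lambda'_4$. Define $$E_1(\vec\lambda)=\lambda_1,\qquad E_2(\vec\lambda)=\frac{1-2\lambda_2}{\lambda_3+\lambda_4},\qquad E_3(\vec\lambda)=\frac{1-2\lambda_2-2\lambda_3}{\lambda_4},$$ with the convention $c/0=+\infty$ for $c>0$. Then $\rho$ can be transformed into $\rho'$ by SLOCC if and only if $E_k(\vec\lambda)\ge E_k(\vec\lambda')$ for $k=1,2,3$.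
   Context: Bell basis: $|\Phi_{1,2}\rangle=\frac{1}{\sqrt2}(|00\rangle\pm|11\rangle)$, $|\Phi_{3,4}\rangle=\frac{1}{\sqrt2}(|01\rangle\pm|10\rangle)$, $\Pi_i=|\Phi_i\rangle\langle\Phi_i|$; a Bell-diagonal state is $\sum_i\lambda_i\Pi_i$ with $\lambda_i\ge0$, $\sum_i\lambda_i=1$. A two-qubit state is entangled if it is not separable (not a convex combination of product states). A state $\rho$ can be transformed into $\rho'$ by SLOCC (stochastic local operations and classical communication) if there exist finitely many $2\times2$ matrices $A_i,B_i$ such that $\sum_i (A_i\otimes B_i)\rho(A_i\otimes B_i)^\dagger=c\,\rho'$ for some $c>0$. *)

(* Defs.v *)
(* R : realType (the real numbers), C := R[i] (complex numbers
   from mathcomp-real-closed), two-qubit operators are 'M[C]_(2*2) with the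
   Kronecker product `*t` (mxtens.v); basis |ab> has index 2*a+b. *)
From HB Require Import structures.
From mathcomp Require Import all_boot all_order all_algebra.
From mathcomp Require Import complex mxtens.
From mathcomp Require Import reals constructive_ereal.

Set Implicit Arguments.
Unset Strict Implicit.
Unset Printing Implicit Defensive.

Import Order.TTheory GRing.Theory Num.Theory.
Local Open Scope ring_scope.
Local Open Scope complex_scope.

Section QuantumDefs.
Variable R : realType.
Local Notation C := R[i].

Definition adjmx m n (A : 'M[C]_(m, n)) : 'M[C]_(n, m) := (map_mx (@conjc R) A)^T.

Definition hermitian n (A : 'M[C]_n) : Prop := adjmx A = A.

Definition psd n (A : 'M[C]_n) : Prop :=
  forall v : 'cV[C]_n, 0 <= (adjmx v *m A *m v) 0 0.

Definition density n (A : 'M[C]_n) : Prop :=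
  hermitian A /\ psd A /\ \tr A = 1.

Definition separable (rho : 'M[C]_(2 * 2)) : Prop :=
  exists (k : nat) (p : 'I_k -> R) (rA rB : 'I_k -> 'M[C]_2),
    (forall i, 0 <= p i) /\ \sum_(i < k) p i = 1 /\
    (forall i, density (rA i) /\ density (rB i)) /\
    rho = \sum_(i < k) (p i)%:C *: (rA i *t rB i).

Definition entangled (rho : 'M[C]_(2 * 2)) : Prop :=
  density rho /\ ~ separable rho.

Definition slocc (rho rho' : 'M[C]_(2 * 2)) : Prop :=
  exists (k : nat) (A B : 'I_k -> 'M[C]_2) (c : R),
    0 < c /\
    \sum_(i < k) ((A i *t B i) *m rho *m adjmx (A i *t B i)) = c%:C *: rho'.

Definition ket (a b : 'I_2) : 'cV[C]_(2 * 2) := delta_mx (mxtens_index (a, b)) 0.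

Definition invsqrt2 : C := (Num.sqrt (2 : R))^-1%:C.

Definition Phi1 : 'cV[C]_(2 * 2) := invsqrt2 *: (ket 0 0 + ket 1 1).
Definition Phi2 : 'cV[C]_(2 * 2) := invsqrt2 *: (ket 0 0 - ket 1 1).
Definition Phi3 : 'cV[C]_(2 * 2) := invsqrt2 *: (ket 0 1 + ket 1 0).
Definition Phi4 : 'cV[C]_(2 * 2) := invsqrt2 *: (ket 0 1 - ket 1 0).

Definition proj (v : 'cV[C]_(2 * 2)) : 'M[C]_(2 * 2) := v *m adjmx v.

Definition bell_diag (l1 l2 l3 l4 : R) : 'M[C]_(2 * 2) :=
  l1%:C *: proj Phi1 + l2%:C *: proj Phi2 + l3%:C *: proj Phi3 + l4%:C *: proj Phi4.

Definition bell_weights (l1 l2 l3 l4 : R) : Prop :=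
  [/\ 0 <= l1, 0 <= l2, 0 <= l3, 0 <= l4 & l1 + l2 + l3 + l4 = 1].

Definition ediv (c d : R) : \bar R := if d == 0 then +oo%E else (c / d)%:E.

Definition E1 (l1 l2 l3 l4 : R) : \bar R := l1%:E.
Definition E2 (l1 l2 l3 l4 : R) : \bar R := ediv (1 - 2 * l2) (l3 + l4).
Definition E3 (l1 l2 l3 l4 : R) : \bar R := ediv (1 - 2 * l2 - 2 * l3) l4.

End QuantumDefs.

(* Main.v *)
(* In Wootters' magic basis Phi1, i Phi2, i Phi3, Phi4 every
   local operator A (x) B becomes a matrix M with M^T M = M M^T = d I.  A Bell-diagonal
   input with weights l is therefore sent to diagonal weights N l with N = |M|^2
   entrywise.  Isotropic vectors built from two columns of M satisfy
   |z_j|^2 <= sum of the other |z_i|^2, and this yields linear inequalities on N.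

   With l1 > 1/2, each condition E_k(l) >= E_k(m) is equivalent to w . m <= 0 for
   w = (1,-t,-t,-t), (1,-1,-t,-t), (1,-1,-1,-t), where t >= 1 is the value making
   w . l = 0 (t = l1/(l2+l3+l4), (l1-l2)/(l3+l4), (l1-l2-l3)/l4).  Necessity is
   w . N l <= 0, checked on the generators of the cone of sorted l.

   Conversely, (2 m1 - 1) l + (l1 - m1) (1,1,0,0) is reachable from l: the second
   term is a separable state.  Its first weight is (2 l1 - 1) m1, and E_2, E_3 say
   exactly that its other three weights majorize those of (2 l1 - 1) m, which is
   then reached by mixing local unitaries that permute Phi2, Phi3, Phi4. *)
Require Import Defs.
From HB Require Import structures.
From mathcomp Require Import all_boot all_order all_algebra.
From mathcomp Require Import complex mxtens ring lra.
From mathcomp Require Import reals constructive_ereal.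
Import Order.TTheory GRing.Theory Num.Theory.
Local Open Scope ring_scope.
Local Open Scope complex_scope.
Import ComplexField.Normc.

Set Implicit Arguments.
Unset Strict Implicit.
Unset Printing Implicit Defensive.

Local Notation o0 := (@Ordinal 4 0 isT).
Local Notation o1 := (@Ordinal 4 1 isT).
Local Notation o2 := (@Ordinal 4 2 isT).
Local Notation o3 := (@Ordinal 4 3 isT).

(** * Sums and case analysis over four and two indices *)

Lemma sum4 (V : nmodType) (P : pred 'I_4) (F : 'I_4 -> V) :
  \sum_(i | P i) F i =
  (if P o0 then F o0 else 0) + (if P o1 then F o1 else 0) +
  (if P o2 then F o2 else 0) + (if P o3 then F o3 else 0).
Proof.
rewrite big_mkcond !big_ord_recr big_ord0 /= add0r.
have e0 : widen_ord (leqnSn 3) (widen_ord (leqnSn 2) (widen_ord (leqnSn 1) ord_max)) = o0 by exact: val_inj.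
have e1 : widen_ord (leqnSn 3) (widen_ord (leqnSn 2) ord_max) = o1 by exact: val_inj.
have e2 : widen_ord (leqnSn 3) ord_max = o2 by exact: val_inj.
have e3 : @ord_max 3 = o3 by exact: val_inj.
by rewrite e0 e1 e2 e3.
Qed.

Lemma forall_ord4 (P : 'I_4 -> Prop) : P o0 -> P o1 -> P o2 -> P o3 -> forall i, P i.
Proof.
move=> h0 h1 h2 h3 [[|[|[|[|//]]]] Hi].
- by rewrite (_ : Ordinal Hi = o0) //; exact: val_inj.
- by rewrite (_ : Ordinal Hi = o1) //; exact: val_inj.
- by rewrite (_ : Ordinal Hi = o2) //; exact: val_inj.
- by rewrite (_ : Ordinal Hi = o3) //; exact: val_inj.
Qed.

Lemma forall_ord2 (P : 'I_2 -> Prop) : P 0 -> P 1 -> forall i, P i.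
Proof.
move=> h0 h1 [[|[|//]] Hi].
- by rewrite (_ : Ordinal Hi = 0) //; exact: val_inj.
- by rewrite (_ : Ordinal Hi = 1) //; exact: val_inj.
Qed.

Lemma sum2 (V : nmodType) (F : 'I_2 -> V) : \sum_i F i = F 0 + F 1.
Proof. by rewrite !big_ord_recl big_ord0 addr0 (_ : lift ord0 ord0 = 1) //; exact: val_inj. Qed.

Section BellDiagonal.
Variable R : realType.
Local Notation C := R[i].

(** * Orthogonal matrices and isotropic vectors *)

Definition sqn (z : C) : R := normc z ^+ 2.

Lemma sqnE (z : C) : sqn z = complex.Re z ^+ 2 + complex.Im z ^+ 2.
Proof. by case: z => x y; rewrite /sqn /= sqr_sqrtr // addr_ge0 ?sqr_ge0. Qed.

Lemma sqn_ge0 z : 0 <= sqn z. Proof. exact: sqr_ge0. Qed.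

Lemma normc_sqr (z : C) : normc (z ^+ 2) = sqn z.
Proof. by rewrite expr2 normcM. Qed.

Lemma mulcJ (z : C) : z * conjc z = (sqn z)%:C.
Proof.
rewrite sqnE; case: z => x y; apply/eqP; rewrite eq_complex /=.
by apply/andP; split; apply/eqP; ring.
Qed.

Lemma sqn_parallelogram (u v : C) :
  sqn (u + 'i%C * v) + sqn (u - 'i%C * v) = 2 * (sqn u + sqn v).
Proof. by rewrite !sqnE; case: u v => [a b] [c d] /=; ring. Qed.

Lemma le_normc_sum (I : finType) (P : pred I) (F : I -> C) :
  normc (\sum_(i | P i) F i) <= \sum_(i | P i) normc (F i).
Proof.
elim/big_ind2: _ => [|x1 x2 y1 y2 h1 h2|//]; first by rewrite normc0.
by apply: le_trans (le_normcD _ _) _; exact: lerD.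
Qed.

(** Triangle inequality for [z j ^+ 2] written as the full sum of squares minus the other squares.
    For an isotropic vector the first term on the right vanishes. *)
Lemma normc_sum_sqr_ge (I : finType) (z : I -> C) (j : I) :
  sqn (z j) <= normc (\sum_i z i ^+ 2) + \sum_(i | i != j) sqn (z i).
Proof.
have -> : sqn (z j) = normc (\sum_i z i ^+ 2 - \sum_(i | i != j) z i ^+ 2).
  by rewrite (bigD1 j) //= addrK normc_sqr.
apply: le_trans (le_normcD _ _) _; rewrite normcN lerD2l.
apply: le_trans (le_normc_sum _ _) _.
by apply: ler_sum => i _; rewrite normc_sqr.
Qed.

Lemma normc_sum_sqr_le (I : finType) (z : I -> C) :
  normc (\sum_i z i ^+ 2) <= \sum_i sqn (z i).
Proof.
apply: le_trans (le_normc_sum _ _) _.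
by apply: ler_sum => i _; rewrite normc_sqr.
Qed.

Section OrthogonalColumns.
Variables (n : nat) (M : 'M[C]_n) (d : C).
Hypothesis MTM : M^T *m M = d%:M.

Lemma col_dot a b : \sum_i M i a * M i b = d *+ (a == b).
Proof.
have := congr1 (fun X : 'M_n => X a b) MTM; rewrite !mxE => <-.
by apply: eq_bigr => i _; rewrite mxE.
Qed.

Lemma col_sqr a : \sum_i M i a ^+ 2 = d.
Proof. by have := col_dot a a; rewrite eqxx. Qed.

Lemma col_entry_le (a j : 'I_n) :
  sqn (M j a) <= normc d + \sum_(i | i != j) sqn (M i a).
Proof.
by have := normc_sum_sqr_ge (M^~ a) j; rewrite col_sqr.
Qed.

Lemma normc_le_col (a : 'I_n) : normc d <= \sum_i sqn (M i a).
Proof.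
by have := normc_sum_sqr_le (M^~ a); rewrite col_sqr.
Qed.

(* Columns a and b are orthogonal of equal bilinear length, so both
   col a + i col b and col a - i col b are isotropic. *)
Lemma col_pair_le (a b j : 'I_n) : a != b ->
  sqn (M j a) + sqn (M j b) <= \sum_(i | i != j) (sqn (M i a) + sqn (M i b)).
Proof.
move=> ab.
(* The cross terms vanish by orthogonality, and the two squares contribute d and -d. *)
have iso (s : C) : s ^+ 2 = -1 -> \sum_i (M i a + s * M i b) ^+ 2 = 0.
  move=> s2; under eq_bigr => i _.
    have -> : (M i a + s * M i b) ^+ 2 =
       M i a * M i a + s *+ 2 * (M i a * M i b) - M i b * M i b.
      by rewrite sqrrD exprMn s2; ring.
    over.
  by rewrite sumrB big_split /= -mulr_sumr !col_dot !eqxx (negPf ab) mulr0 addr0 subrr.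
have i2 : ('i%C : C) ^+ 2 = -1 by exact: sqr_i.
have h1 := normc_sum_sqr_ge (fun i => M i a + 'i%C * M i b) j.
have h2 := normc_sum_sqr_ge (fun i => M i a + (- 'i%C) * M i b) j.
rewrite iso // normc0 add0r in h1.
rewrite iso ?sqrrN // normc0 add0r in h2.
(* After doubling, the parallelogram law turns each pair of squared moduli into the sum of those for
   s = i and s = -i. *)
rewrite -(ler_pM2l (ltr0Sn R 1)) mulr_sumr -sqn_parallelogram.
under eq_bigr => i _ do rewrite -sqn_parallelogram.
rewrite big_split /= -mulNr; apply: lerD => //.
by under eq_bigr => i _ do rewrite -mulNr.
Qed.

End OrthogonalColumns.

(** * Linear inequalities on the squared moduli of an orthogonal matrix *)

Section Witnesses.
Variables (M : 'M[C]_4) (d : C).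
Hypotheses (MTM : M^T *m M = d%:M) (MMT : M *m M^T = d%:M).

Let N (j k : 'I_4) : R := sqn (M j k).

Let D : R := normc d.

Let N_ge0 j k : 0 <= N j k. Proof. exact: sqn_ge0. Qed.

Let col_pair a b : a != b -> N o0 a + N o0 b <=
  (N o1 a + N o1 b) + (N o2 a + N o2 b) + (N o3 a + N o3 b).
Proof. by move=> ab; have := col_pair_le MTM o0 ab; rewrite sum4 /= add0r. Qed.

Let col0_le : N o0 o0 <= D + (N o1 o0 + N o2 o0 + N o3 o0).
Proof. by have := col_entry_le MTM o0 o0; rewrite sum4 /= add0r. Qed.

Let MTTMT : (M^T)^T *m M^T = d%:M. Proof. by rewrite trmxK. Qed.

Let row_ge j : D <= N j o0 + N j o1 + N j o2 + N j o3.
Proof. by have := normc_le_col MTTMT j; rewrite sum4 /= !mxE. Qed.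

(** Rows 2 and 3 together have mass at least 2D, and by the pair inequality for the transpose their
    last column carries at most half of that mass. *)
Let row_pair_ge : D <= (N o2 o0 + N o2 o1 + N o2 o2) + (N o3 o0 + N o3 o1 + N o3 o2).
Proof.
have := col_pair_le MTTMT o3 (isT : o2 != o3).
rewrite sum4 /= addr0 !mxE => h; have h2 := row_ge o2; have h3 := row_ge o3.
by rewrite /N in h h2 h3 *; lra.
Qed.

Section Weights.
Variables (l1 l2 l3 l4 t : R).

Let out j := N j o0 * l1 + N j o1 * l2 + N j o2 * l3 + N j o3 * l4.

(** Once [l1] is substituted, both sides are linear in (l2, l3, l4), so it suffices to check the
    three unit vectors; [gen] does this by pairing column 0 with column k. *)
Lemma witness1 : 1 <= t -> 0 <= l2 -> 0 <= l3 -> 0 <= l4 ->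
  l1 = t * (l2 + l3 + l4) -> out o0 <= t * (out o1 + out o2 + out o3).
Proof.
move=> t1 h2 h3 h4 el1; rewrite /out el1.
(* The difference is a convex quadratic in t, nonpositive at 0 and nonnegative at 1. *)
have gen k : k != o0 -> t * N o0 o0 + N o0 k <=
    t * (t * (N o1 o0 + N o2 o0 + N o3 o0) + (N o1 k + N o2 k + N o3 k)).
  move=> k0; have := @col_pair o0 k; rewrite eq_sym => /(_ k0) h.
  have p1 : 0 <= t * (t - 1) * (N o1 o0 + N o2 o0 + N o3 o0).
    by rewrite mulr_ge0 ?(addr_ge0 (addr_ge0 _ _)) // mulr_ge0 //; lra.
  have p2 : 0 <= (t - 1) * N o0 k by rewrite mulr_ge0 // subr_ge0.
  have p3 : 0 <= t * (N o1 o0 + N o1 k + (N o2 o0 + N o2 k) + (N o3 o0 + N o3 k) - (N o0 o0 + N o0 k)).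
    by rewrite mulr_ge0 //; lra.
  by lra.
have e1 := ler_wpM2r h2 (gen o1 isT); have e2 := ler_wpM2r h3 (gen o2 isT).
have e3 := ler_wpM2r h4 (gen o3 isT).
by lra.
Qed.

Hypotheses (t1 : 1 <= t) (h4 : 0 <= l4) (h43 : l4 <= l3) (h32 : l3 <= l2).

Let p01 := @col_pair o0 o1 isT.

Let p02 := @col_pair o0 o2 isT.

Let p03 := @col_pair o0 o3 isT.

(* The sorted (l2, l3, l4) are generated by (1,0,0), (1,1,0), (1,1,1); on each
   generator the inequality is a convex quadratic in t, nonnegative with
   nonnegative derivative at 1. *)
Lemma witness2 : l1 = l2 + t * (l3 + l4) ->
  out o0 <= out o1 + t * (out o2 + out o3).
Proof.
(* Each generator inequality is expanded in powers of s: the constant term comes from the column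
   pairs, the linear term from [sc], [sr], [s2], [s3] and [q], the quadratic term from [qq]. *)
move=> el1; rewrite /out el1; set s := t - 1; have s0 : 0 <= s by rewrite subr_ge0.
have q j k : 0 <= s * N j k by rewrite mulr_ge0.
have qq j k : 0 <= s * s * N j k by exact: (mulr_ge0 (mulr_ge0 s0 s0)).
have sc := ler_wpM2l s0 col0_le; have sr := ler_wpM2l s0 row_pair_ge.
have s2 := ler_wpM2l s0 (row_ge o2); have s3 := ler_wpM2l s0 (row_ge o3).
have g1 : N o0 o0 + N o0 o1 <= N o1 o0 + N o1 o1 + t * (N o2 o0 + N o2 o1 + (N o3 o0 + N o3 o1)).
  have := q o2 o0; have := q o2 o1; have := q o3 o0; have := q o3 o1.
  by move: p01; rewrite /s; lra.
have g2 : (1 + t) * N o0 o0 + N o0 o1 + N o0 o2 <= (1 + t) * N o1 o0 + N o1 o1 + N o1 o2 +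
   t * ((1 + t) * N o2 o0 + N o2 o1 + N o2 o2 + ((1 + t) * N o3 o0 + N o3 o1 + N o3 o2)).
  have := qq o2 o0; have := qq o3 o0; have := q o2 o0; have := q o3 o0.
  by move: p01 p02 sc sr; rewrite /s; lra.
have g3 : (1 + 2 * t) * N o0 o0 + N o0 o1 + N o0 o2 + N o0 o3 <=
   (1 + 2 * t) * N o1 o0 + N o1 o1 + N o1 o2 + N o1 o3 +
   t * ((1 + 2 * t) * N o2 o0 + N o2 o1 + N o2 o2 + N o2 o3 +
        ((1 + 2 * t) * N o3 o0 + N o3 o1 + N o3 o2 + N o3 o3)).
  have := qq o2 o0; have := qq o3 o0; have := q o2 o0; have := q o3 o0.
  by move: p01 p02 p03 sc s2 s3; rewrite /s; lra.
(* The coefficients of (l2, l3, l4) on the three generators are l2 - l3, l3 - l4 and l4. *)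
have d32 : 0 <= l2 - l3 by rewrite subr_ge0.
have d43 : 0 <= l3 - l4 by rewrite subr_ge0.
have e1 := ler_wpM2r d32 g1; have e2 := ler_wpM2r d43 g2; have e3 := ler_wpM2r h4 g3.
by lra.
Qed.

(** Same generators as for [witness2]. Here [l1] involves t only on (1,1,1), so [g1] and [g2] are
    affine in t and only [g3] calls on the bounds through D. *)
Lemma witness3 : l1 = l2 + l3 + t * l4 ->
  out o0 <= out o1 + out o2 + t * out o3.
Proof.
move=> el1; rewrite /out el1; set s := t - 1; have s0 : 0 <= s by rewrite subr_ge0.
have q j k : 0 <= s * N j k by rewrite mulr_ge0.
have qq j k : 0 <= s * s * N j k by exact: (mulr_ge0 (mulr_ge0 s0 s0)).
have sc := ler_wpM2l s0 col0_le; have s3 := ler_wpM2l s0 (row_ge o3).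
have g1 : N o0 o0 + N o0 o1 <= N o1 o0 + N o1 o1 + (N o2 o0 + N o2 o1) + t * (N o3 o0 + N o3 o1).
  have := q o3 o0; have := q o3 o1; by move: p01; rewrite /s; lra.
have g2 : 2 * N o0 o0 + N o0 o1 + N o0 o2 <= 2 * N o1 o0 + N o1 o1 + N o1 o2 +
   (2 * N o2 o0 + N o2 o1 + N o2 o2) + t * (2 * N o3 o0 + N o3 o1 + N o3 o2).
  have := q o3 o0; have := q o3 o1; have := q o3 o2.
  by move: p01 p02; rewrite /s; lra.
have g3 : (2 + t) * N o0 o0 + N o0 o1 + N o0 o2 + N o0 o3 <=
   (2 + t) * N o1 o0 + N o1 o1 + N o1 o2 + N o1 o3 +
   ((2 + t) * N o2 o0 + N o2 o1 + N o2 o2 + N o2 o3) +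
   t * ((2 + t) * N o3 o0 + N o3 o1 + N o3 o2 + N o3 o3).
  have := qq o3 o0; have := q o3 o0.
  by move: p01 p02 p03 sc s3; rewrite /s; lra.
have d32 : 0 <= l2 - l3 by rewrite subr_ge0.
have d43 : 0 <= l3 - l4 by rewrite subr_ge0.
have e1 := ler_wpM2r d32 g1; have e2 := ler_wpM2r d43 g2; have e3 := ler_wpM2r h4 g3.
by lra.
Qed.

End Weights.
End Witnesses.

(** * The magic basis *)

Definition magic : 'M[C]_(2 * 2) :=
  \matrix_(i, j) nth 0 [:: Phi1 R; 'i%C *: Phi2 R; 'i%C *: Phi3 R; Phi4 R] j i 0.

Definition magic_tab (im : C) : seq (seq C) :=
  [:: [:: 1; im; 0; 0]; [:: 0; 0; im; 1]; [:: 0; 0; im; -1]; [:: 1; - im; 0; 0]].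

Lemma magicE (i j : 'I_4) :
  magic i j = invsqrt2 R * nth 0 (nth [::] (magic_tab 'i%C) i) j.
Proof.
rewrite mxE; move: i j; apply: forall_ord4; apply: forall_ord4;
rewrite !mxE !eqE /= ?eqE /=; ring.
Qed.

(** Written as an expression equal to 0 so that it can be added to one side of an entrywise goal
    before [ring]. *)
Lemma invsqrt2_sqrB1 : 2 * invsqrt2 R ^+ 2 - 1 = 0.
Proof.
rewrite /invsqrt2 -rmorphXn /= exprVn sqr_sqrtr ?ler0n // fmorphV rmorph_nat.
by rewrite mulfV ?subrr ?pnatr_eq0.
Qed.

Lemma conj_invsqrt2 : conjc (invsqrt2 R) = invsqrt2 R.
Proof. exact: conjc_real. Qed.

(* sigma_y up to a phase. *)
Definition spin : 'M[C]_2 := delta_mx 0 1 - delta_mx 1 0.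

(** In the magic basis the bilinear form [spin *t spin] becomes the standard dot product; this is
    what makes local operators complex orthogonal up to a scalar. *)
Lemma magic_mulT : magic *m magic^T = spin *t spin.
Proof.
have i2 : ('i%C : C) ^+ 2 = -1 by exact: sqr_i.
have s2 := invsqrt2_sqrB1.
apply/matrixP=> i j; rewrite [LHS]mxE (sum4 xpredT) /= !(mxE trmx_key) !magicE.
move: ('i%C : C) (invsqrt2 R) i2 s2 => im s i2 s2.
move: i j; apply: forall_ord4; apply: forall_ord4; rewrite !mxE !eqE /=;
first [ring: i2 | rewrite -[RHS]addr0 -[X in _ = _ + X]s2; ring: i2
                | rewrite -[RHS]subr0 -[X in _ = _ - X]s2; ring: i2].
Qed.

Lemma magic_unitary : adjmx magic *m magic = 1%:M.
Proof.
have i2 : ('i%C : C) ^+ 2 = -1 by exact: sqr_i.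
have ic : conjc ('i%C : C) = - 'i%C by apply/eqP; rewrite eq_complex /= oppr0 !eqxx.
have s2 := invsqrt2_sqrB1; have sc := conj_invsqrt2.
apply/matrixP=> i j; rewrite [LHS]mxE (sum4 xpredT) /= /adjmx !(mxE trmx_key) !(mxE map_mx_key) !magicE.
move: ('i%C : C) (invsqrt2 R) i2 s2 ic sc => im s i2 s2 ic sc.
move: i j; apply: forall_ord4; apply: forall_ord4; rewrite !mxE !eqE /=
  ?(rmorphM, rmorphN, rmorph1, rmorph0) /= ?(ic, sc, conjc1, conjc0);
first [ring: i2 | rewrite -[RHS]addr0 -[X in _ = _ + X]s2; ring: i2].
Qed.

Let det2 (A : 'M[C]_2) := A 0 0 * A 1 1 - A 0 1 * A 1 0.

Lemma trmx_spin (A : 'M[C]_2) : A^T *m spin *m A = det2 A *: spin.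
Proof.
apply/matrixP; apply: forall_ord2; apply: forall_ord2;
  rewrite !(mxE, sum2) /det2 !eqE /=; ring.
Qed.

Lemma spin_trmx (A : 'M[C]_2) : A *m spin *m A^T = det2 A *: spin.
Proof. by rewrite -{1}[A]trmxK trmx_spin /det2 !mxE; congr (_ *: _); ring. Qed.

Definition magic_conj (A B : 'M[C]_2) : 'M[C]_(2 * 2) :=
  adjmx magic *m (A *t B) *m magic.

Lemma adjmxM m n p (A : 'M[C]_(m, n)) (B : 'M[C]_(n, p)) :
  adjmx (A *m B) = adjmx B *m adjmx A.
Proof. by rewrite /adjmx map_mxM trmx_mul. Qed.

Lemma adjmxK m n (A : 'M[C]_(m, n)) : adjmx (adjmx A) = A.
Proof. by apply/matrixP=> i j; rewrite !mxE conjcK. Qed.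

Lemma magicbar_mulT : (adjmx magic)^T *m adjmx magic = spin *t spin.
Proof.
rewrite /adjmx trmxK -{2}[magic]trmxK !map_trmx trmxK -map_mxM magic_mulT map_mxT.
have -> // : map_mx conjc spin = spin.
by rewrite map_mxB !map_delta_mx.
Qed.

(** Each factor rescales the antisymmetric form [spin] by its determinant, so d = det A det B. Since
    d may be 0, neither identity implies the other and both are proved. *)
Lemma magic_conj_orthogonal A B :
  exists d, (magic_conj A B)^T *m magic_conj A B = d%:M /\
            magic_conj A B *m (magic_conj A B)^T = d%:M.
Proof.
exists (det2 A * det2 B); set Q := magic; set P := adjmx Q.
have PQ : P *m Q = 1%:M := magic_unitary.
have spin2 (X Y : 'M[C]_2) a b : X = a *: spin -> Y = b *: spin ->
    X *t Y = (a * b) *: (spin *t spin).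
  move=> -> ->; apply/matrixP=> i j; rewrite !mxE; ring.
rewrite /magic_conj -/Q -/P; split.
- have e : (A^T *t B^T) *m (spin *t spin) *m (A *t B) = (det2 A * det2 B) *: (spin *t spin).
    by rewrite !tensmx_mul; apply: spin2; exact: trmx_spin.
  rewrite !trmx_mul trmx_tens -!mulmxA [P^T *m _]mulmxA magicbar_mulT !mulmxA.
  rewrite -[Q^T *m _ *m _]mulmxA -[Q^T *m _ *m _]mulmxA e -scalemxAr -scalemxAl.
  have -> : Q^T *m (spin *t spin) *m Q = (P *m Q)^T *m (P *m Q).
    by rewrite trmx_mul -magicbar_mulT !mulmxA.
  by rewrite PQ trmx1 mulmx1 scalemx1.
- have e : (A *t B) *m (spin *t spin) *m (A^T *t B^T) = (det2 A * det2 B) *: (spin *t spin).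
    by rewrite !tensmx_mul; apply: spin2; exact: spin_trmx.
  rewrite !trmx_mul trmx_tens -!mulmxA [Q *m (Q^T *m _)]mulmxA magic_mulT !mulmxA.
  rewrite -[P *m _ *m _]mulmxA -[P *m _ *m _]mulmxA e -scalemxAr -scalemxAl.
  have -> : P *m (spin *t spin) *m P^T = (P *m Q) *m (P *m Q)^T.
    by rewrite trmx_mul -magic_mulT !mulmxA.
  by rewrite PQ trmx1 mulmx1 scalemx1.
Qed.

Lemma proj_entry (v : 'cV[C]_(2 * 2)) i j : proj v i j = v i 0 * conjc (v j 0).
Proof. by rewrite mxE big_ord1 !mxE. Qed.

Lemma bell_diag_entry a b c d i j :
  bell_diag a b c d i j =
  a%:C * (Phi1 R i 0 * conjc (Phi1 R j 0)) + b%:C * (Phi2 R i 0 * conjc (Phi2 R j 0)) +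
  c%:C * (Phi3 R i 0 * conjc (Phi3 R j 0)) + d%:C * (Phi4 R i 0 * conjc (Phi4 R j 0)).
Proof.
have addE (X Y : 'M[C]_(2 * 2)) : (X + Y) i j = X i j + Y i j by rewrite mxE.
have scaleE s (X : 'M[C]_(2 * 2)) : (s *: X) i j = s * X i j by rewrite mxE.
rewrite -(proj_entry (Phi1 R)) -(proj_entry (Phi2 R)) -(proj_entry (Phi3 R)) -(proj_entry (Phi4 R)).
rewrite /bell_diag.
by move: (proj (Phi1 R)) (proj (Phi2 R)) (proj (Phi3 R)) (proj (Phi4 R)) => *; rewrite !addE !scaleE.
Qed.

Definition im : C := 'i%C.

Lemma i_sqr : im ^+ 2 = -1. Proof. exact: sqr_i. Qed.

Lemma mulcJ1 : 1 * conjc (1 : C) = 1.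
Proof. by rewrite mulcJ sqnE /=; congr (_%:C); ring. Qed.

Lemma mulcJi : im * conjc im = 1.
Proof. by rewrite mulcJ sqnE /=; congr (_%:C); ring. Qed.

Lemma mulcJNi : (- im) * conjc (- im) = 1.
Proof. by rewrite mulcJ sqnE /=; congr (_%:C); ring. Qed.

Definition wt (l1 l2 l3 l4 : R) (k : 'I_4) : R := [:: l1; l2; l3; l4]`_k.

(** The phases i on Phi2 and Phi3 have modulus 1 and cancel in the projectors. *)
Lemma bell_diagE l1 l2 l3 l4 : bell_diag l1 l2 l3 l4 =
  magic *m diag_mx (\row_k (wt l1 l2 l3 l4 k)%:C) *m adjmx magic.
Proof.
apply/matrixP=> i j; rewrite bell_diag_entry.
have entryE k (v : 'cV[C]_(2 * 2)) (s : C) (l : R) : (forall i, magic i k = s * v i 0) ->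
    s * conjc s = 1 -> magic i k * l%:C * adjmx magic k j = l%:C * (v i 0 * conjc (v j 0)).
  move=> Qk ss; have -> : adjmx magic k j = conjc (magic j k) by rewrite /adjmx mxE mxE.
  by rewrite !Qk rmorphM /= -[RHS]mulr1 -ss; ring.
have prodE k : (magic *m diag_mx (\row_k (wt l1 l2 l3 l4 k)%:C)) i k = magic i k * (wt l1 l2 l3 l4 k)%:C.
  by rewrite mul_mx_diag !mxE.
rewrite [RHS]mxE (sum4 xpredT) /= !prodE.
rewrite (entryE o0 (Phi1 R) 1) ?mulcJ1 // ?(entryE o1 (Phi2 R) 'i%C) ?mulcJi //.
rewrite ?(entryE o2 (Phi3 R) 'i%C) ?mulcJi // ?(entryE o3 (Phi4 R) 1) ?mulcJ1 //.
all: by move=> k; rewrite [LHS]mxE /= 1?mxE ?mul1r.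
Qed.

Lemma adjmx_magic_bell m1 m2 m3 m4 (j : 'I_4) :
  (adjmx magic *m bell_diag m1 m2 m3 m4 *m magic) j j = (wt m1 m2 m3 m4 j)%:C.
Proof.
rewrite bell_diagE !mulmxA magic_unitary mul1mx -mulmxA magic_unitary mulmx1.
by rewrite !mxE eqxx.
Qed.

Lemma adjmx_magic_kraus A B l1 l2 l3 l4 (j : 'I_4) (K := A *t B) :
  (adjmx magic *m (K *m bell_diag l1 l2 l3 l4 *m adjmx K) *m magic) j j =
  (\sum_k sqn (magic_conj A B j k) * wt l1 l2 l3 l4 k)%:C.
Proof.
have -> : adjmx magic *m (K *m bell_diag l1 l2 l3 l4 *m adjmx K) *m magic =
    magic_conj A B *m diag_mx (\row_k (wt l1 l2 l3 l4 k)%:C) *m adjmx (magic_conj A B).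
  by rewrite bell_diagE /magic_conj !adjmxM adjmxK !mulmxA.
rewrite [LHS]mxE rmorph_sum /=; apply: eq_bigr => k _.
rewrite rmorphM /= -mulcJ mul_mx_diag !mxE.
by rewrite mulrAC.
Qed.

(** * Weights reachable by local operations *)

Local Notation op := ('M[C]_2 * 'M[C]_2)%type.

Definition kraus (L : seq op) (rho : 'M[C]_(2 * 2)) : 'M[C]_(2 * 2) :=
  \sum_(p <- L) (p.1 *t p.2) *m rho *m adjmx (p.1 *t p.2).

(** Weights are unnormalized and the operators form a list: sums become concatenation, and a
    subsequent local operation becomes a map. *)
Definition reach (rho : 'M[C]_(2 * 2)) (a b c d : R) : Prop :=
  exists L, kraus L rho = bell_diag a b c d.

Lemma adjmxZ m n (s : C) (A : 'M[C]_(m, n)) : adjmx (s *: A) = conjc s *: adjmx A.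
Proof. by apply/matrixP=> i j; rewrite !mxE rmorphM. Qed.

Lemma conjc_real_complex (x : R) : conjc (x%:C : C) = x%:C.
Proof. exact: conjc_real. Qed.

Lemma tensmxZ (s : C) (A B : 'M[C]_2) : (s *: A) *t B = s *: (A *t B).
Proof. by apply/matrixP=> i j; rewrite !mxE mulrA. Qed.

Lemma bell_diagD a b c d a' b' c' d' :
  bell_diag a b c d + bell_diag a' b' c' d' =
  bell_diag (a + a') (b + b') (c + c') (d + d') :> 'M[C]_(2 * 2).
Proof.
rewrite /bell_diag.
move: (proj (Phi1 R)) (proj (Phi2 R)) (proj (Phi3 R)) (proj (Phi4 R)) => P1 P2 P3 P4.
rewrite !rmorphD !scalerDl.
by do 2 (rewrite addrACA; congr (_ + _)); rewrite addrACA.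
Qed.

Lemma bell_diagZ s a b c d :
  s%:C *: bell_diag a b c d = bell_diag (s * a) (s * b) (s * c) (s * d) :> 'M[C]_(2 * 2).
Proof.
rewrite /bell_diag.
move: (proj (Phi1 R)) (proj (Phi2 R)) (proj (Phi3 R)) (proj (Phi4 R)) => P1 P2 P3 P4.
by rewrite !rmorphM !scalerDr !scalerA.
Qed.

Section Closure.
Variable rho : 'M[C]_(2 * 2).

Lemma reach_add a b c d a' b' c' d' : reach rho a b c d -> reach rho a' b' c' d' ->
  reach rho (a + a') (b + b') (c + c') (d + d').
Proof.
by move=> [L hL] [L' hL']; exists (L ++ L'); rewrite /kraus big_cat /= -bell_diagD -hL -hL'.
Qed.

Lemma kraus_post (U V : 'M[C]_2) L : kraus [seq (U *m p.1, V *m p.2) | p <- L] rho =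
  (U *t V) *m kraus L rho *m adjmx (U *t V).
Proof.
rewrite /kraus big_map mulmx_sumr mulmx_suml; apply: eq_bigr => p _ /=.
by rewrite -tensmx_mul adjmxM !mulmxA.
Qed.

Lemma reach_post (U V : 'M[C]_2) a b c d a' b' c' d' :
  (U *t V) *m bell_diag a b c d *m adjmx (U *t V) = bell_diag a' b' c' d' ->
  reach rho a b c d -> reach rho a' b' c' d'.
Proof.
by move=> e [L hL]; exists [seq (U *m p.1, V *m p.2) | p <- L]; rewrite kraus_post hL.
Qed.

Lemma reach_scale s a b c d : 0 <= s -> reach rho a b c d ->
  reach rho (s * a) (s * b) (s * c) (s * d).
Proof.
move=> s0 [L hL]; exists [seq ((Num.sqrt s)%:C *: p.1, p.2) | p <- L].
rewrite /kraus big_map -bell_diagZ -hL scaler_sumr; apply: eq_bigr => p _ /=.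
rewrite tensmxZ adjmxZ -!scalemxAl -!scalemxAr scalerA conjc_real_complex -rmorphM /=.
by rewrite -expr2 sqr_sqrtr.
Qed.

End Closure.

(** * Permuting and averaging the Bell weights by local operations *)

Definition mx22 (a b c d : C) : 'M[C]_2 :=
  \matrix_(i, j) nth 0 (nth [::] [:: [:: a; b]; [:: c; d]] i) j.

Lemma mul_proj (K : 'M[C]_(2 * 2)) (s r : C) v w : s * conjc s = r ->
  K *m v = s *: w -> K *m proj v *m adjmx K = r *: proj w.
Proof.
move=> <- e; rewrite /proj !mulmxA e -mulmxA -adjmxM e adjmxZ.
by rewrite -scalemxAl -scalemxAr scalerA.
Qed.

Lemma conj_mixture n (K P1 P2 P3 P4 Q1 Q2 Q3 Q4 : 'M[C]_n) (r a b c d : C) :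
  K *m P1 *m adjmx K = r *: Q1 -> K *m P2 *m adjmx K = r *: Q2 ->
  K *m P3 *m adjmx K = r *: Q3 -> K *m P4 *m adjmx K = r *: Q4 ->
  K *m (a *: P1 + b *: P2 + c *: P3 + d *: P4) *m adjmx K =
  r *: (a *: Q1 + b *: Q2 + c *: Q3 + d *: Q4).
Proof.
move=> e1 e2 e3 e4; rewrite !mulmxDr !mulmxDl -!scalemxAr -!scalemxAl e1 e2 e3 e4.
by rewrite !scalerDr !scalerA ![r * _]mulrC.
Qed.

Local Ltac mul_bell :=
  apply/colP; apply: forall_ord4; rewrite mxE (sum4 xpredT) !mxE !eqE /=;
  generalize i_sqr; generalize im (invsqrt2 R); let i2 := fresh in intros ? ? i2; ring: i2.

Section Swaps.
Variable rho : 'M[C]_(2 * 2).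

(** Phase gates diag(1,i) on both sides send |11> to -|11> and multiply |01> and |10> by i. *)
Lemma reach_swap12 a b c d : reach rho a b c d -> reach rho b a c d.
Proof.
apply: (@reach_post rho (mx22 1 0 0 im) (mx22 1 0 0 im)).
set K := _ *t _.
have e1 : K *m Phi1 R = 1 *: Phi2 R by mul_bell.
have e2 : K *m Phi2 R = 1 *: Phi1 R by mul_bell.
have e3 : K *m Phi3 R = im *: Phi3 R by mul_bell.
have e4 : K *m Phi4 R = im *: Phi4 R by mul_bell.
rewrite /bell_diag (conj_mixture _ _ _ _ (mul_proj mulcJ1 e1) (mul_proj mulcJ1 e2)
  (mul_proj mulcJi e3) (mul_proj mulcJi e4)).
move: (proj (Phi1 R)) (proj (Phi2 R)) (proj (Phi3 R)) (proj (Phi4 R)) => P1 P2 P3 P4.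
by rewrite scale1r (addrC (a%:C *: _)).
Qed.

(** The opposite phases i and -i fix |00> and |11> and create a relative sign between |01> and
    |10>. *)
Lemma reach_swap34 a b c d : reach rho a b c d -> reach rho a b d c.
Proof.
apply: (@reach_post rho (mx22 1 0 0 im) (mx22 1 0 0 (- im))).
set K := _ *t _.
have e1 : K *m Phi1 R = 1 *: Phi1 R by mul_bell.
have e2 : K *m Phi2 R = 1 *: Phi2 R by mul_bell.
have e3 : K *m Phi3 R = (- im) *: Phi4 R by mul_bell.
have e4 : K *m Phi4 R = (- im) *: Phi3 R by mul_bell.
rewrite /bell_diag (conj_mixture _ _ _ _ (mul_proj mulcJ1 e1) (mul_proj mulcJ1 e2)
  (mul_proj mulcJNi e3) (mul_proj mulcJNi e4)).
move: (proj (Phi1 R)) (proj (Phi2 R)) (proj (Phi3 R)) (proj (Phi4 R)) => P1 P2 P3 P4.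
by rewrite scale1r -!addrA (addrC (c%:C *: _)).
Qed.

Lemma reach_swap23 a b c d : reach rho a b c d -> reach rho a c b d.
Proof.
(* An unnormalized Hadamard matrix: the factor 4 avoids square roots. *)
pose H : 'M[C]_2 := mx22 1 1 1 (-1).
have swap4 : (H *t H) *m bell_diag a b c d *m adjmx (H *t H) = bell_diag (4 * a) (4 * c) (4 * b) (4 * d).
  set K := _ *t _.
  have e1 : K *m Phi1 R = 2 *: Phi1 R by mul_bell.
  have e2 : K *m Phi2 R = 2 *: Phi3 R by mul_bell.
  have e3 : K *m Phi3 R = 2 *: Phi2 R by mul_bell.
  have e4 : K *m Phi4 R = (- 2) *: Phi4 R by mul_bell.
  have m2 : 2 * conjc (2 : C) = 4%:C by rewrite mulcJ sqnE /=; congr (_%:C); ring.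
  have mN2 : - 2 * conjc (- 2 : C) = 4%:C by rewrite mulcJ sqnE /=; congr (_%:C); ring.
  rewrite -bell_diagZ /bell_diag (conj_mixture _ _ _ _
    (mul_proj m2 e1) (mul_proj m2 e2) (mul_proj m2 e3) (mul_proj mN2 e4)).
  move: (proj (Phi1 R)) (proj (Phi2 R)) (proj (Phi3 R)) (proj (Phi4 R)) => P1 P2 P3 P4.
  by rewrite (addrAC _ (b%:C *: _)).
move=> h; have := @reach_scale rho 4^-1 _ _ _ _ _ (reach_post swap4 h).
have q x : 4^-1 * (4 * x) = x :> R by rewrite mulKf ?pnatr_eq0.
by rewrite !q; apply; rewrite invr_ge0 ler0n.
Qed.

Lemma reach_swap24 a b c d : reach rho a b c d -> reach rho a d c b.
Proof. by move/reach_swap23/reach_swap34/reach_swap23. Qed.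

Lemma reach_transfer23 a b c d b' c' : b' + c' = b + c -> c <= b' <= b ->
  reach rho a b c d -> reach rho a b' c' d.
Proof.
move=> bc /andP[cb' b'b] h.
have ec : c' = b + c - b' by lra.
have [ebc|bc0] := eqVneq b c.
  have e : b' = b by apply/eqP; rewrite eq_le b'b ebc.
  by rewrite ec e addrAC subrr add0r.
have bc1 : 0 < b - c by rewrite subr_gt0 lt_neqAle eq_sym bc0 (le_trans cb').
(* The solution of s b + (1 - s) c = b': keep the state with weight s and swap it with weight 1 -
   s. *)
pose s := (b' - c) / (b - c).
have s0 : 0 <= s by apply: divr_ge0; [rewrite subr_ge0|exact: ltW].
have s1 : 0 <= 1 - s by rewrite subr_ge0 ler_pdivrMr // mul1r lerD2r.
have := reach_add (reach_scale s0 h) (reach_scale s1 (reach_swap23 h)).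
have -> : s * a + (1 - s) * a = a by ring.
have -> : s * d + (1 - s) * d = d by ring.
have se : s * (b - c) = b' - c by rewrite /s divfK // lt0r_neq0.
have -> : s * b + (1 - s) * c = b' by rewrite -[RHS](subrK c) -se; ring.
by have -> : s * c + (1 - s) * b = c' by rewrite ec -[b' in RHS](subrK c) -se; ring.
Qed.

Lemma reach_transfer34 a b c d c' d' : c' + d' = c + d -> d <= c' <= c ->
  reach rho a b c d -> reach rho a b c' d'.
Proof.
by move=> e le /reach_swap24/reach_swap23/(reach_transfer23 e le)/reach_swap23/reach_swap24.
Qed.

Lemma reach_transfer24 a b c d b' d' : b' + d' = b + d -> d <= b' <= b ->
  reach rho a b c d -> reach rho a b' c d'.
Proof. by move=> e le /reach_swap34/(reach_transfer23 e le)/reach_swap34. Qed.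

(** Two transfers suffice: the first brings the middle weight to c', taking from b if c <= c' and
    giving to d otherwise; the second settles the other two. *)
Lemma reach_majorized a b c d b' c' d' :
  b' + c' + d' = b + c + d -> d' <= c' -> c' <= b' -> b' <= b -> d <= d' ->
  reach rho a b c d -> reach rho a b' c' d'.
Proof.
move=> e dc cb b'b dd' h.
have [cc'|c'c] := leP c c'.
  apply: (@reach_transfer24 _ (b + c - c') _ d); [lra|lra|].
  by apply: reach_transfer23 h; lra.
apply: (@reach_transfer24 _ b _ (d + c - c')); [lra|lra|].
by apply: reach_transfer34 h; lra.
Qed.

End Swaps.

(** * Preparing the mixture of |00> and |11> *)

Lemma delta_mulmx_delta n (A : 'M[C]_n) (i j k l : 'I_n) :
  delta_mx i j *m A *m delta_mx k l = A j k *: delta_mx i l.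
Proof.
rewrite -(mul_delta_mx (ord0 : 'I_1) i j) -!mulmxA [_ *m (A *m _)]mulmxA -rowE.
rewrite -(mul_delta_mx (ord0 : 'I_1) k l) [row j A *m _]mulmxA -colE.
rewrite [col k _]mx11_scalar mul_scalar_mx -scalemxAr mul_delta_mx.
by rewrite !mxE.
Qed.

Lemma proj_Phi12 : proj (Phi1 R) + proj (Phi2 R) = delta_mx o0 o0 + delta_mx o3 o3.
Proof.
have s2 := invsqrt2_sqrB1; have sc := conj_invsqrt2.
have addE (X Y : 'M[C]_(2 * 2)) i j : (X + Y) i j = X i j + Y i j by rewrite mxE.
apply/matrixP=> i j; rewrite addE !proj_entry /Phi1 /Phi2.
move: (invsqrt2 R) s2 sc => s s2 sc.
move: i j; apply: forall_ord4; apply: forall_ord4; rewrite !mxE !eqE /=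
  ?(rmorphM, rmorphD, rmorphN, rmorph1, rmorph0) /= ?(sc, conjc1, conjc0);
first [ring | rewrite -[RHS]addr0 -[X in _ = _ + X]s2; ring].
Qed.

Lemma bell_diag_pair r :
  bell_diag r r 0 0 = r%:C *: (delta_mx o0 o0 + delta_mx o3 o3) :> 'M[C]_(2 * 2).
Proof.
rewrite -proj_Phi12 /bell_diag.
move: (proj (Phi1 R)) (proj (Phi2 R)) (proj (Phi3 R)) (proj (Phi4 R)) => P1 P2 P3 P4.
by rewrite rmorph0 !scale0r !addr0 scalerDr.
Qed.

(** The operators |00><00| and |11><00| keep only the |00> population r and prepare |00> and |11>
    with equal weight. *)
Lemma reach_pair (rho : 'M[C]_(2 * 2)) r : 0 < r -> rho o0 o0 = r%:C -> reach rho 1 1 0 0.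
Proof.
move=> r0 e.
suff h : reach rho r r 0 0.
  have ri : 0 <= r^-1 by rewrite invr_ge0 ltW.
  have := reach_scale ri h; rewrite mulVf ?mulr0 //; exact: lt0r_neq0.
exists [:: (mx22 1 0 0 0, mx22 1 0 0 0); (mx22 0 0 1 0, mx22 0 0 1 0)].
have e0 : mx22 1 0 0 0 *t mx22 1 0 0 0 = delta_mx o0 o0.
  by apply/matrixP; apply: forall_ord4; apply: forall_ord4; rewrite !mxE !eqE /=; ring.
have e3 : mx22 0 0 1 0 *t mx22 0 0 1 0 = delta_mx o3 o0.
  by apply/matrixP; apply: forall_ord4; apply: forall_ord4; rewrite !mxE !eqE /=; ring.
have adj_delta i j : adjmx (delta_mx i j : 'M[C]_(2 * 2)) = delta_mx j i.
  by rewrite /adjmx map_delta_mx trmx_delta.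
rewrite /kraus !big_cons big_nil addr0 /fst /snd e0 e3 !adj_delta.
by rewrite !delta_mulmx_delta e bell_diag_pair scalerDr.
Qed.

(** * Separable Bell-diagonal states *)

Lemma reach_slocc rho s a b c d : 0 < s ->
  reach rho (s * a) (s * b) (s * c) (s * d) -> slocc rho (bell_diag a b c d).
Proof.
move=> s0 [L hL]; pose nt i : 'M[C]_2 * 'M[C]_2 := nth (0, 0) L i.
exists (size L), (fun i => (nt i).1), (fun i => (nt i).2), s; split=> //.
by rewrite bell_diagZ -hL /kraus (big_nth (0, 0)) big_mkord.
Qed.

Lemma adjmx_tens (A B : 'M[C]_2) : adjmx (A *t B) = adjmx A *t adjmx B.
Proof. by rewrite /adjmx map_mxT trmx_tens. Qed.

Section PureStates.
Local Notation E0 := (delta_mx 0 0 : 'M[C]_2).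
Implicit Type A : 'M[C]_2.

Definition nrm A : R := sqn (A 0 0) + sqn (A 1 0).

(** The normalized state A|0><0|A^*. If A|0> = 0 the value |0><0| keeps it a density matrix, and
    [pureE] gives it coefficient 0. *)
Definition pure A : 'M[C]_2 :=
  if nrm A == 0 then E0 else (nrm A)^-1%:C *: (A *m E0 *m adjmx A).

Lemma rank1E A : A *m E0 *m adjmx A = col 0 A *m adjmx (col 0 A).
Proof.
rewrite -(mul_delta_mx (ord0 : 'I_1)) mulmxA -colE -mulmxA -rowE; congr (_ *m _).
by apply/matrixP=> i j; rewrite !mxE.
Qed.

Lemma density_rank1 A : nrm A != 0 ->
  density ((nrm A)^-1%:C *: (A *m E0 *m adjmx A)).
Proof.
move=> n0; have n1 : 0 <= (nrm A)^-1 by rewrite invr_ge0 addr_ge0 ?sqn_ge0.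
rewrite rank1E; split; [|split].
- by rewrite /Defs.hermitian adjmxZ conjc_real_complex adjmxM adjmxK.
- move=> v; rewrite -scalemxAr -scalemxAl mxE mulr_ge0 ?ler0c // !mulmxA -[_ *m _ *m v]mulmxA.
  have -> : adjmx (col 0 A) *m v = adjmx (adjmx v *m col 0 A) by rewrite adjmxM adjmxK.
  move: (adjmx v *m _) => z; have zE : adjmx z 0 0 = conjc (z 0 0) by rewrite /adjmx mxE mxE.
  by rewrite mxE big_ord1 zE mulcJ ler0c sqn_ge0.
- rewrite mxtraceZ /mxtrace sum2 !mxE !big_ord1 !mxE !mulcJ -rmorphD -rmorphM /=.
  by rewrite mulVf.
Qed.

Lemma pure_density A : density (pure A).
Proof.
rewrite /pure; have [_|] := eqVneq; last exact: density_rank1.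
have n1 : nrm 1%:M = 1 by rewrite /nrm !mxE !sqnE /=; ring.
have := @density_rank1 1%:M; rewrite n1 oner_eq0 invr1 scale1r mul1mx => /(_ isT).
by rewrite /adjmx map_mx1 trmx1 mulmx1.
Qed.

Lemma pureE A : A *m E0 *m adjmx A = (nrm A)%:C *: pure A.
Proof.
rewrite /pure; have [n0|n0] := eqVneq; last by rewrite scalerA -rmorphM mulfV // scale1r.
have : sqn (A 0 0) + sqn (A 1 0) == 0 by apply/eqP.
rewrite paddr_eq0 ?sqn_ge0 // => /andP[/eqP z0 /eqP z1].
have zero (z : C) : sqn z = 0 -> z = 0.
  by move=> /eqP; rewrite sqrf_eq0 => /eqP /eq0_normc.
rewrite n0 rmorph0 scale0r rank1E (_ : col 0 A = 0) ?mul0mx //.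
by apply/colP; apply: forall_ord2; rewrite !mxE; apply: zero.
Qed.

End PureStates.

Lemma mxtrace_tens (A B : 'M[C]_2) : \tr (A *t B) = \tr A * \tr B.
Proof.
rewrite /mxtrace (sum4 xpredT) /= !sum2 !mxE.
have -> : mxtens_unindex (o0 : 'I_(2 * 2)) = (0, 0) by apply/eqP.
have -> : mxtens_unindex (o1 : 'I_(2 * 2)) = (0, 1) by apply/eqP.
have -> : mxtens_unindex (o2 : 'I_(2 * 2)) = (1, 0) by apply/eqP.
have -> : mxtens_unindex (o3 : 'I_(2 * 2)) = (1, 1) by apply/eqP.
by rewrite /=; ring.
Qed.

(** Local operators send the product state |00><00| to multiples of pure product states; comparing
    traces shows that the coefficients sum to 1. *)
Lemma reach_separable a b c d : \tr (bell_diag a b c d : 'M[C]_(2 * 2)) = 1 ->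
  reach (delta_mx o0 o0) a b c d -> separable (bell_diag a b c d).
Proof.
move=> tr1 [L hL]; pose nt i : 'M[C]_2 * 'M[C]_2 := nth (0, 0) L i.
have e00 : delta_mx o0 o0 = delta_mx 0 0 *t delta_mx 0 0 :> 'M[C]_(2 * 2).
  by apply/matrixP; apply: forall_ord4; apply: forall_ord4; rewrite !mxE !eqE /=; ring.
have dec : bell_diag a b c d =
    \sum_(i < size L) (nrm (nt i).1 * nrm (nt i).2)%:C *: (pure (nt i).1 *t pure (nt i).2).
  rewrite -hL /kraus (big_nth (0, 0)) big_mkord e00; apply: eq_bigr => i _.
  rewrite adjmx_tens !tensmx_mul !pureE; apply/matrixP=> x y; rewrite !mxE rmorphM.
  by rewrite mulrACA.
exists (size L), (fun i => nrm (nt i).1 * nrm (nt i).2),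
  (fun i => pure (nt i).1), (fun i => pure (nt i).2).
split; first by move=> i; rewrite mulr_ge0 // addr_ge0 ?sqn_ge0.
split; last by split => // i; split; exact: pure_density.
apply: (@complexI R); rewrite rmorph1 -[RHS]tr1 dec rmorph_sum raddf_sum; apply: eq_bigr => i _ /=.
have [_ [_ t1]] := pure_density (nt i).1; have [_ [_ t2]] := pure_density (nt i).2.
by rewrite mxtraceZ mxtrace_tens t1 t2 !mulr1.
Qed.

(** If a <= 1/2, the weights are a nonnegative combination of vectors with two entries 1 and two
    entries 0. These are all reachable from |00><00|, so the state would be separable. *)
Lemma entangled_gt a b c d : bell_weights a b c d -> b <= a -> c <= b -> d <= c ->
  entangled (bell_diag a b c d : 'M[C]_(2 * 2)) -> 1 < 2 * a.
Proof.
move=> [a0 b0 c0 d0 s1] ba cb dc [[_ [_ tr1]] nsep]; rewrite ltNge; apply/negP => a2; apply: nsep.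
apply: reach_separable => //; set rho := delta_mx _ _.
have p12 : reach rho 1 1 0 0 by apply: (@reach_pair _ 1); rewrite ?mxE.
have p13 : reach rho 1 0 1 0 := reach_swap23 p12.
have p14 : reach rho 1 0 0 1 := reach_swap34 p13.
have p23 : reach rho 0 1 1 0 := reach_swap12 p13.
have p24 : reach rho 0 1 0 1 := reach_swap34 p23.
have p34 : reach rho 0 0 1 1 := reach_swap23 p24.
have comb x12 x13 x14 x23 x34 : 0 <= x12 -> 0 <= x13 -> 0 <= x14 -> 0 <= x23 -> 0 <= x34 ->
    a = x12 + x13 + x14 -> b = x12 + x23 -> c = x13 + x23 + x34 -> d = x14 + x34 -> reach rho a b c d.
  move=> h12 h13 h14 h23 h34 -> -> -> ->.
  have := reach_add (reach_add (reach_add (reach_add (reach_scale h12 p12) (reach_scale h13 p13))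
    (reach_scale h14 p14)) (reach_scale h23 p23)) (reach_scale h34 p34).
  by rewrite !mulr0 !mulr1 !addr0 !add0r.
have [le|gt] := leP (a + d) (b + c).
(* Removing d (1,1,1,1) leaves three weights satisfying the triangle inequalities. *)
  apply: (comb ((a + b - c - d) / 2 + d) ((a + c - b - d) / 2) 0 ((b + c - a - d) / 2) d); lra.
(* Removing e (1,1,1,1) leaves weights whose first is the sum of the others. *)
pose e := (b + c + d - a) / 2.
apply: (comb b (c - e) (d - e) 0 e); rewrite /e; lra.
Qed.

(** * The characterization *)

(** Positive numerators make cross-multiplication agree with the convention c/0 = +oo, including
    when one or both denominators vanish. *)
Lemma lee_ediv (c d c' d' : R) : 0 < c -> 0 < c' -> 0 <= d -> 0 <= d' ->
  (ediv c' d' <= ediv c d)%E = (c' * d <= c * d').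
Proof.
move=> c0 c'0 d0 d'0; rewrite /ediv; have [->|dn0] := eqVneq d 0.
  by rewrite leey mulr0 mulr_ge0 // ltW.
have dp : 0 < d by rewrite lt_neqAle eq_sym dn0.
have [->|d'n0] := eqVneq d' 0.
  by rewrite leye_eq mulr0 leNgt mulr_gt0.
have d'p : 0 < d' by rewrite lt_neqAle eq_sym d'n0.
by rewrite lee_fin ler_pdivrMr // mulrAC ler_pdivlMr // mulrC.
Qed.

Lemma reach_refl a b c d : reach (bell_diag a b c d) a b c d.
Proof.
exists [:: (1%:M, 1%:M)]; rewrite /kraus big_seq1 /fst /snd.
have -> : 1%:M *t 1%:M = 1%:M :> 'M[C]_(2 * 2).
  by apply/matrixP; apply: forall_ord4; apply: forall_ord4; rewrite !mxE !eqE /=; ring.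
by rewrite /adjmx map_mx1 trmx1 mulmx1 mul1mx.
Qed.

Lemma bell_diag00 a b c d : (bell_diag a b c d : 'M[C]_(2 * 2)) o0 o0 = ((a + b) / 2)%:C.
Proof.
have s2 := invsqrt2_sqrB1.
have half : invsqrt2 R * conjc (invsqrt2 R) = 2^-1.
  rewrite conj_invsqrt2 -expr2; move: s2 => /eqP; rewrite subr_eq0 => /eqP s2'.
  by apply: (mulfI (x := 2)); rewrite ?pnatr_eq0 // mulfV ?pnatr_eq0.
rewrite bell_diag_entry.
have -> : Phi1 R o0 0 = invsqrt2 R by rewrite !mxE !eqE /= addr0 mulr1.
have -> : Phi2 R o0 0 = invsqrt2 R by rewrite !mxE !eqE /= subr0 mulr1.
have -> : Phi3 R o0 0 = 0 by rewrite !mxE !eqE /= addr0 mulr0.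
have -> : Phi4 R o0 0 = 0 by rewrite !mxE !eqE /= subr0 mulr0.
rewrite !half !mul0r !mulr0 !addr0 -mulrDl -rmorphD rmorphM fmorphV.
by rewrite rmorph_nat.
Qed.

(** Obtained by comparing diagonal entries in the magic basis. *)
Lemma slocc_weights l1 l2 l3 l4 m1 m2 m3 m4 :
  slocc (bell_diag l1 l2 l3 l4 : 'M[C]_(2 * 2)) (bell_diag m1 m2 m3 m4) ->
  exists (c : R) (k : nat) (A B : 'I_k -> 'M[C]_2), 0 < c /\
    forall j : 'I_4, c * wt m1 m2 m3 m4 j = \sum_(i < k)
      (sqn (magic_conj (A i) (B i) j o0) * l1 + sqn (magic_conj (A i) (B i) j o1) * l2 +
       sqn (magic_conj (A i) (B i) j o2) * l3 + sqn (magic_conj (A i) (B i) j o3) * l4).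
Proof.
move=> [k [A [B [c [c0 e]]]]]; exists c, k, A, B; split=> // j.
apply: (@complexI R); rewrite rmorphM rmorph_sum /= -adjmx_magic_bell.
have -> : c%:C * (adjmx magic *m bell_diag m1 m2 m3 m4 *m magic) j j =
          (adjmx magic *m (c%:C *: bell_diag m1 m2 m3 m4) *m magic) j j.
  by rewrite -scalemxAr -scalemxAl [in RHS]mxE.
rewrite -e mulmx_sumr mulmx_suml summxE; apply: eq_bigr => i _.
by rewrite adjmx_magic_kraus (sum4 xpredT).
Qed.

End BellDiagonal.

Theorem theorem2 (R : realType) (l1 l2 l3 l4 m1 m2 m3 m4 : R) :
  bell_weights l1 l2 l3 l4 -> bell_weights m1 m2 m3 m4 ->
  entangled (bell_diag l1 l2 l3 l4) -> entangled (bell_diag m1 m2 m3 m4) ->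
  l2 <= l1 -> l3 <= l2 -> l4 <= l3 ->
  m2 <= m1 -> m3 <= m2 -> m4 <= m3 ->
  (slocc (bell_diag l1 l2 l3 l4) (bell_diag m1 m2 m3 m4) <->
   [/\ (E1 m1 m2 m3 m4 <= E1 l1 l2 l3 l4)%E,
       (E2 m1 m2 m3 m4 <= E2 l1 l2 l3 l4)%E &
       (E3 m1 m2 m3 m4 <= E3 l1 l2 l3 l4)%E]).
Proof.
move=> wl wm el em l21 l32 l43 m21 m32 m43.
have gl := entangled_gt wl l21 l32 l43 el.
have gm := entangled_gt wm m21 m32 m43 em.
case: wl => l1_0 l2_0 l3_0 l4_0 sl; case: wm => m1_0 m2_0 m3_0 m4_0 sm.
rewrite /E1 /E2 /E3 lee_fin !lee_ediv; [|lra..].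
split=> [/slocc_weights [c [k [A [B [c0 cm]]]]] | [e1 e2 e3]].
  have c0' := cm o0; have c1' := cm o1; have c2' := cm o2; have c3' := cm o3.
  rewrite /wt /= in c0' c1' c2' c3'.
  have cancel x y : c * x <= c * y -> x <= y by rewrite ler_pM2l.
  split.
  - have [z|nz] := eqVneq (l2 + l3 + l4) 0; first by lra.
    have p : 0 < l2 + l3 + l4 by rewrite lt_neqAle eq_sym nz !addr_ge0.
    (* This ratio is at least 1 because l1 > 1/2; the same bound gives t >= 1 in the next two
       cases. *)
    have t1 : 1 <= l1 / (l2 + l3 + l4) by rewrite ler_pdivlMr // mul1r; lra.
    have : m1 <= l1 / (l2 + l3 + l4) * (m2 + m3 + m4).
      (* Multiplying by c replaces each m_j by its sum over operators, and the inequality then holds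
         term by term. *)
      apply: cancel; rewrite mulrCA !mulrDr c0' c1' c2' c3' -!mulrDr -!big_split mulr_sumr /=.
      apply: ler_sum => i _; have [d [M1 M2]] := magic_conj_orthogonal (A i) (B i).
      by apply: (witness1 M1) => //; rewrite divfK.
    by rewrite mulrAC ler_pdivlMr //; move=> h; nra.
  - have [z|nz] := eqVneq (l3 + l4) 0; first by rewrite z mulr0 mulr_ge0 //; lra.
    have p : 0 < l3 + l4 by rewrite lt_neqAle eq_sym nz !addr_ge0.
    have t1 : 1 <= (l1 - l2) / (l3 + l4) by rewrite ler_pdivlMr // mul1r; lra.
    have : m1 <= m2 + (l1 - l2) / (l3 + l4) * (m3 + m4).
      apply: cancel; rewrite mulrDr mulrCA !mulrDr c0' c1' c2' c3' -!mulrDr -!big_split mulr_sumr -big_split /=.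
      apply: ler_sum => i _; have [d [M1 M2]] := magic_conj_orthogonal (A i) (B i).
      by apply: (witness2 M1 M2) => //; rewrite divfK // addrC subrK.
    (* By normalization, cross-multiplying adds the same product (l3 + l4)(m3 + m4) to both
       sides. *)
    have -> : 1 - 2 * m2 = m1 - m2 + (m3 + m4) by lra.
    have -> : 1 - 2 * l2 = l1 - l2 + (l3 + l4) by lra.
    by rewrite -lerBlDl mulrAC ler_pdivlMr // => h; move: h; lra.
  - have [z|nz] := eqVneq l4 0; first by rewrite z mulr0 mulr_ge0 //; lra.
    have p : 0 < l4 by rewrite lt_neqAle eq_sym nz.
    have t1 : 1 <= (l1 - l2 - l3) / l4 by rewrite ler_pdivlMr // mul1r; lra.
    have : m1 <= m2 + m3 + (l1 - l2 - l3) / l4 * m4.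
      apply: cancel; rewrite !mulrDr mulrCA c0' c1' c2' c3' -!big_split mulr_sumr -big_split /=.
      apply: ler_sum => i _; have [d [M1 M2]] := magic_conj_orthogonal (A i) (B i).
      by apply: (witness3 M1 M2) => //; rewrite divfK //; ring.
    have -> : 1 - 2 * m2 - 2 * m3 = m1 - (m2 + m3) + m4 by lra.
    have -> : 1 - 2 * l2 - 2 * l3 = l1 - l2 - l3 + l4 by lra.
    by rewrite -lerBlDl mulrAC ler_pdivlMr // => h; move: h; lra.
have pair : reach (bell_diag l1 l2 l3 l4) 1 1 0 0.
  by apply: (@reach_pair R _ ((l1 + l2) / 2) _ (bell_diag00 _ _ _ _)); lra.
have g0 : 0 <= 2 * m1 - 1 by lra.
have f0 : 0 <= l1 - m1 by lra.
(* Both coefficients are nonnegative: m1 > 1/2, and [e1] gives m1 <= l1. *)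
have := reach_add (reach_scale g0 (reach_refl l1 l2 l3 l4))
  (reach_scale f0 pair).
rewrite !mulr0 !mulr1 !addr0.
have -> : (2 * m1 - 1) * l1 + (l1 - m1) = (2 * l1 - 1) * m1 by ring.
move=> h; apply: (@reach_slocc R _ (2 * l1 - 1)); first by lra.
have em1 : m2 = 1 - m1 - m3 - m4 by lra.
have el1 : l2 = 1 - l1 - l3 - l4 by lra.
have gp : 0 <= 2 * l1 - 1 by lra.
apply: reach_majorized h.
- by rewrite em1 el1; ring.
- exact: ler_wpM2l.
- exact: ler_wpM2l.
(* After eliminating l2 and m2, [e2] reads (2 m1 - 1)(l3 + l4) <= (2 l1 - 1)(m3 + m4). As the totals
   agree, this bounds the largest of the three weights; [e3] likewise bounds the smallest. *)
- by move: e2; rewrite em1 el1; lra.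
- by move: e3; rewrite em1 el1; lra.
Qed.
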